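(* Let $\varphi$ be a $\mathrm{TeamLTL}^a(\sim)$-formula. Then for all non-empty trace sets $T$: $$T\models\varphi\Leftrightarrow\mathcal{M}_T\models_{S^x_T} ST_x(\varphi).$$
   Context: $\mathrm{TeamLTL}^a(\sim)$ is linear temporal logic under asynchronous team semantics (a team is a set $T$ of traces $t\in(2^{\mathrm{AP}})^\omega$; splitjunction $\vee$ splits the team; $T\models^a \varphi U\psi$ iff there is $f\colon T\to\mathbb{N}$ with $T[f,\infty)\models\psi$ and $T[f',\infty)\models\varphi$ for all $f'<f$ componentwise; $X$ advances all traces by one) extended with Boolean negation $T\models\sim\varphi\iff T\not\models\varphi$. A set of traces $T$ is encoded by the first-order structure $\mathcal{M}_T$ with domain $T\times\mathbb{N}$, $\leq^{\mathcal{M}_T}=\{((t_i,n),(t_j,m))\mid i=j, n\le m\}$ and $P_i^{\mathcal{M}_T}=\{(t_k,j)\mid p_i\in t_k(j)\}$. The first-order team is $S^x_T=\{s\mid s(x)=(t,0), t\in T\}$. First-order formulas are evaluated in (lax) team semantics, with dependence atoms $=\!(x_1,\dots,x_n,y)$ (true in a team $S$ iff any two assignments agreeing on $x_1,\dots,x_n$ agree on $y$) and Boolean negation $\sim$. $S(x,y)$ abbreviates $x<y\wedge\forall z(z\le x\vee y\le z\vee(\neg x\le z\wedge\neg z\le x))$. The translation $ST_u$ ($u\in\{x,y,z\}$) is defined by $ST_x(p_i)=P_i(x)$, $ST_x(\neg p_i)=\neg P_i(x)$, commuting with $\wedge,\vee,\sim$, $ST_x(X\varphi)=\exists y(S(x,y)\wedge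 ST_y(\varphi))$, and $ST_x(\varphi U\psi)=\exists y(x\le y\wedge =\!(x,y)\wedge ST_y(\psi)\wedge\sim\exists z(x\le z\wedge z\le y\wedge =\!(x,z)\wedge\sim ST_z(\varphi)))$ (analogously for $y,z$).
   Formalization: In the translation of U the bound z≤y is replaced by z<y (else p U ¬p fails), and teams are read as indexed families, so traces whose suffixes become equal stay distinct members of T[f,∞) (with plain sets the equivalence fails). *)

(* Defs.v *)
From mathcomp Require Import all_boot.
From mathcomp Require Import boolp classical_sets.

Set Implicit Arguments.
Unset Strict Implicit.
Unset Printing Implicit Defensive.

Local Open Scope classical_set_scope.

Definition trace (AP : Type) := nat -> set AP.

Inductive ltl (AP : Type) : Type :=
| LProp of AP
| LNProp of AP
| LAnd of ltl AP & ltl AP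
| LOr of ltl AP & ltl AP
| LNot of ltl AP                (* Boolean negation ~ *)
| LNext of ltl AP
| LUntil of ltl AP & ltl AP.

(* A team is a set [T] of names together with the trace [t i] named by each
   [i \in T].  Taking suffixes changes [t] but not [T], so traces that become
   equal after being advanced remain distinct members of the team, just as the
   elements (t_i, n) and (t_j, m), i <> j, remain distinct in M_T.  (If
   T[f, oo) were collapsed to a plain set of traces, the two sides of the
   theorem could disagree: take T = {t1, t2} with t1 <> t2 having the same
   suffix (p, not p)^omega from position 1 on, and the formula
   X((p \/ not p) U (~p /\ ~(not p))).)  A plain set of traces is the team in
   which every trace names itself, see [team_sat]. *)
Definition team_suffix AP I (t : I -> trace AP) (f : I -> nat) : I -> trace AP :=
  fun i k => t i (f i + k).

(* Only the values of [f] and [f'] on [T] are relevant, so the functions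
   T -> nat are represented by functions on all of [I]. *)
Fixpoint fam_sat AP I (t : I -> trace AP) (T : set I) (phi : ltl AP) : Prop :=
  match phi with
  | LProp p => forall i, T i -> t i 0 p
  | LNProp p => forall i, T i -> ~ t i 0 p
  | LAnd phi1 phi2 => fam_sat t T phi1 /\ fam_sat t T phi2
  | LOr phi1 phi2 => exists T1 T2 : set I,
      [/\ T = T1 `|` T2, fam_sat t T1 phi1 & fam_sat t T2 phi2]
  | LNot phi1 => ~ fam_sat t T phi1
  | LNext phi1 => fam_sat (team_suffix t (fun=> 1)) T phi1
  | LUntil phi1 phi2 => exists f : I -> nat,
      fam_sat (team_suffix t f) T phi2 /\
      forall f' : I -> nat, (forall i, T i -> f' i < f i) ->
        fam_sat (team_suffix t f') T phi1
  end.

Definition team_sat AP (T : set (trace AP)) (phi : ltl AP) : Prop :=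
  fam_sat (fun t : trace AP => t) T phi.

Definition fvar := nat.
Definition vx : fvar := 0.
Definition vy : fvar := 1.
Definition vz : fvar := 2.

Inductive fo_atom (AP : Type) : Type :=
| AEq of fvar & fvar
| ALe of fvar & fvar
| APred of AP & fvar.

Inductive fo (AP : Type) : Type :=
| FPos of fo_atom AP
| FNeg of fo_atom AP            (* the literal "not a", distinct from ~ a *)
| FDep of seq fvar & fvar       (* =!(x_1, ..., x_n, y) *)
| FAnd of fo AP & fo AP
| FOr of fo AP & fo AP
| FNot of fo AP                 (* Boolean negation ~ *)
| FEx of fvar & fo AP
| FAll of fvar & fo AP.

Record fo_struct (AP : Type) := FOStruct {
  dom : Type;
  le_rel : dom -> dom -> Prop;
  pred_rel : AP -> set dom }.

(* Assignments have a domain of their own: [s v = None] means that [v] is not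
   in the domain of [s]. *)
Definition assignment (D : Type) := fvar -> option D.

Definition upd D (s : assignment D) (v : fvar) (a : D) : assignment D :=
  fun w => if w == v then Some a else s w.

Definition atom_holds AP (M : fo_struct AP) (s : assignment (dom M))
    (a : fo_atom AP) : Prop :=
  match a with
  | AEq u v => exists d, s u = Some d /\ s v = Some d
  | ALe u v => exists d e, [/\ s u = Some d, s v = Some e & le_rel d e]
  | APred p u => exists d, s u = Some d /\ pred_rel p d
  end.

Fixpoint fo_sat AP (M : fo_struct AP) (S : set (assignment (dom M)))
    (phi : fo AP) : Prop :=
  match phi with
  | FPos a => forall s, S s -> atom_holds s a
  | FNeg a => forall s, S s -> ~ atom_holds s a
  | FDep xs y => forall s s', S s -> S s' ->
      (forall x, x \in xs -> s x = s' x) -> s y = s' y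
  | FAnd phi1 phi2 => fo_sat S phi1 /\ fo_sat S phi2
  | FOr phi1 phi2 => exists S1 S2 : set (assignment (dom M)),
      [/\ S = S1 `|` S2, fo_sat S1 phi1 & fo_sat S2 phi2]
  | FNot phi1 => ~ fo_sat S phi1
  | FEx v phi1 => exists F : assignment (dom M) -> set (dom M),
      (forall s, S s -> F s !=set0) /\
      fo_sat [set s' | exists s a, [/\ S s, F s a & s' = upd s v a]] phi1
  | FAll v phi1 =>
      fo_sat [set s' | exists s a, S s /\ s' = upd s v a] phi1
  end.

Arguments fo_sat {AP} M S phi.

Definition trace_struct AP (T : set (trace AP)) : fo_struct AP :=
  @FOStruct AP (set_type T * nat)%type
    (fun a b => a.1 = b.1 /\ a.2 <= b.2)
    (fun p a => val a.1 a.2 p).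

Definition init_team AP (T : set (trace AP)) (u : fvar) :
    set (assignment (dom (trace_struct T))) :=
  [set s | exists t : set_type T, s = upd (fun=> None) u (t, 0)].

Arguments init_team {AP} T u.

Definition fle AP (u v : fvar) : fo AP := FPos (ALe AP u v).
Definition fnle AP (u v : fvar) : fo AP := FNeg (ALe AP u v).
Definition flt AP (u v : fvar) : fo AP := FAnd (fle AP u v) (FNeg (AEq AP u v)).

Definition fsucc AP (u v w : fvar) : fo AP :=
  FAnd (flt AP u v)
    (FAll w (FOr (FOr (fle AP w u) (fle AP v w))
                 (FAnd (fnle AP u w) (fnle AP w u)))).

(* [ST u v w] translates at the variable [u], with [v] and [w] the two other
   variables in cyclic order, so that ST_x, ST_y and ST_z are
   [ST vx vy vz], [ST vy vz vx] and [ST vz vx vy].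
   In the clause for U the bound [w < v] is strict because the semantics of U
   quantifies over f' < f; with [w <= v] the translation would also impose
   phi1 at the positions given by f, and already p U (not p) on a single trace
   would not be translated correctly. *)
Fixpoint ST AP (u v w : fvar) (phi : ltl AP) : fo AP :=
  match phi with
  | LProp p => FPos (APred p u)
  | LNProp p => FNeg (APred p u)
  | LAnd phi1 phi2 => FAnd (ST u v w phi1) (ST u v w phi2)
  | LOr phi1 phi2 => FOr (ST u v w phi1) (ST u v w phi2)
  | LNot phi1 => FNot (ST u v w phi1)
  | LNext phi1 => FEx v (FAnd (fsucc AP u v w) (ST v w u phi1))
  | LUntil phi1 phi2 =>
      FEx v (FAnd (fle AP u v) (FAnd (FDep AP [:: u] v) (FAnd (ST v w u phi2)
        (FNot (FEx w (FAnd (fle AP u w) (FAnd (flt AP w v)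
          (FAnd (FDep AP [:: u] w) (FNot (ST w u v phi1))))))))))
  end.

Definition ST_x AP (phi : ltl AP) : fo AP := ST vx vy vz phi.

(* Main.v *)
Require Import Defs.
From mathcomp Require Import all_boot.
From mathcomp Require Import boolp classical_sets.

(** By induction on the formula, with the advanced team and the first-order
    team generalized: the truth of [ST u v w phi] in a first-order team [S]
    depends only on the values of [u] in [S], provided that these values are
    [(i, g i)] for [i] in a set [T] of traces, and then it agrees with the truth
    of [phi] in [T[g, oo)].  The atom =!(u, v) and the constraint that [v] is the
    successor of [u] both preserve this functional shape, so an existential
    quantifier for [v] amounts to the choice of one function [f : T -> nat],
    however many assignments of [S] share the same value of [u]. *)

Set Implicit Arguments.
Unset Strict Implicit.
Unset Printing Implicit Defensive.

Local Open Scope classical_set_scope.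

Section Translation.

Variables (AP : Type) (X : set (trace AP)).

Local Notation D := (dom (trace_struct X)).
Local Notation team := (set (assignment D)).

(** * First-order teams encoding an advanced LTL team *)

Definition supplement (S : team) (v : fvar) (F : assignment D -> set D) : team :=
  [set s' | exists s a, [/\ S s, F s a & s' = upd s v a]].

(** Only [u] is constrained, so values left in other variables by earlier quantifiers are harmless,
    and several assignments may stand for one trace. *)
Definition represents (S : team) (u : fvar) (T : set (trace AP))
    (g : trace AP -> nat) : Prop :=
  (forall s, S s -> exists2 i : set_type X,
     T (val i) & s u = Some (i, g (val i))) /\
  (forall t, T t -> exists s (i : set_type X),
     [/\ S s, s u = Some (i, g t) & val i = t]).

Lemma upd_eq (s : assignment D) v a : upd s v a v = Some a.
Proof. by rewrite /upd eqxx. Qed.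

Lemma upd_neq (s : assignment D) (v : fvar) a (u : fvar) : u != v -> upd s v a u = s u.
Proof. by rewrite /upd => /negbTE->. Qed.

Lemma team_suffixD (t : trace AP -> trace AP) g f :
  team_suffix (team_suffix t g) f = team_suffix t (fun i => g i + f i).
Proof. by apply/funext => i; apply/funext => k; rewrite /team_suffix addnA. Qed.

Lemma represents_supplement S (u v : fvar) T g F : u != v ->
  (forall s, S s -> F s !=set0) ->
  represents S u T g -> represents (supplement S v F) u T g.
Proof.
move=> uv F0 [Su Tu]; split=> [_ [s [a [Ss _ ->]]]|t Tt].
  by rewrite upd_neq//; exact: Su.
have [s [i [Ss si it]]] := Tu _ Tt; have [a Fa] := F0 _ Ss.
exists (upd s v a), i; split => //; last by rewrite upd_neq.
by exists s, a.
Qed.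

(** The order atom keeps [v] on the trace of [u], at a later or equal position; the dependence atom
    makes that position a function of the value of [u], hence of the trace alone. Subtracting [g]
    gives the offset. *)
Lemma represents_dep S u v T g : represents S u T g ->
  fo_sat (trace_struct X) S (fle AP u v) ->
  fo_sat (trace_struct X) S (FDep AP [:: u] v) ->
  exists f, represents S v T (fun t => g t + f t).
Proof.
move=> [Su Tu] uv dep.
have /choice[f fP] : forall t, exists n, forall s (i : set_type X),
    S s -> s u = Some (i, g t) -> val i = t -> s v = Some (i, g t + n).
  (* Outside [T] no assignment sits on the trace, so 0 is a dummy offset. *)
  move=> t; have [Tt|nTt] := pselect (T t); last first.
    exists 0 => s i Ss si it; have [j Tj] := Su _ Ss.
    by rewrite si => -[ij _]; case: nTt; rewrite -it ij.
  have [s [i [Ss si it]]] := Tu _ Tt.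
  have [d [[j m] [sd sv]]] := uv _ Ss.
  move: sd; rewrite si => -[<-] [/= ij gm].
  exists (m - g t) => s' i' Ss' si' it'; rewrite subnKC//.
  have ii' : i' = i by apply: val_inj; exact: etrans it' (esym it).
  rewrite ii' in si' *; rewrite ij -sv; apply: dep => // x.
  by rewrite mem_seq1 => /eqP->; rewrite si si'.
exists f; split=> [s Ss|t Tt].
  by have [i Ti si] := Su _ Ss; exists i => //; exact: fP.
by have [s [i [Ss si it]]] := Tu _ Tt; exists s, i; split => //; exact: fP.
Qed.

(** Converse to [represents_dep]: the supplementing function that realizes a given [f]. Its value is
    a singleton determined by [s u], or empty if [s u] is undefined. *)
Definition shift (u : fvar) (f : trace AP -> nat) (s : assignment D) : set D :=
  [set a | exists2 b, s u = Some b & a = (b.1, b.2 + f (val b.1))].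

Lemma shift_neq0 S u T g f : represents S u T g ->
  forall s, S s -> shift u f s !=set0.
Proof.
move=> [Su _] s /Su[i Ti si].
by exists (i, g (val i) + f (val i)), (i, g (val i)).
Qed.

Lemma represents_shift S u v T g f : represents S u T g ->
  represents (supplement S v (shift u f)) v T (fun t => g t + f t).
Proof.
move=> [Su Tu]; split=> [_ [s [a [Ss [b sb ->] ->]]]|t Tt].
  have [i Ti] := Su _ Ss; rewrite sb => -[->].
  by exists i => //; rewrite upd_eq.
have [s [i [Ss si it]]] := Tu _ Tt.
exists (upd s v (i, g t + f t)), i; split => //; last by rewrite upd_eq.
exists s, (i, g t + f t); split => //.
by exists (i, g t) => //=; rewrite it.
Qed.

Lemma fle_shift S (u v : fvar) T g f : u != v -> represents S u T g ->
  fo_sat (trace_struct X) (supplement S v (shift u f)) (fle AP u v).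
Proof.
move=> uv [Su _] _ [s [a [Ss [b sb ->] ->]]].
exists b, (b.1, b.2 + f (val b.1)).
by rewrite upd_neq// upd_eq; split => //=; split => //; rewrite leq_addr.
Qed.

Lemma dep_shift S (u v : fvar) f : u != v ->
  fo_sat (trace_struct X) (supplement S v (shift u f)) (FDep AP [:: u] v).
Proof.
move=> uv _ _ [s [a [Ss [b sb ->] ->]]] [s' [a' [Ss' [b' sb' ->] ->]]].
move=> /(_ u); rewrite mem_seq1 eqxx => /(_ isT).
by rewrite !upd_eq !upd_neq// sb sb' => -[->].
Qed.

(** * Strict order and successor in first-order teams *)

Lemma flt_represents S u v T g h :
  represents S u T g -> represents S v T h ->
  (forall s, S s -> exists i m n, s u = Some (i, m) /\ s v = Some (i, n)) ->
  fo_sat (trace_struct X) S (flt AP u v) <-> forall t, T t -> g t < h t.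
Proof.
move=> [Su Tu] [Sv Tv] Suv; split=> [[le_uv neq_uv] t Tt|lt_gh].
  have [s [i [Ss si it]]] := Tu _ Tt.
  have [j Tj sj] := Sv _ Ss.
  have [d [e [sd se [/= de1 de2]]]] := le_uv _ Ss.
  move: sd de1 de2 se; rewrite si sj => -[<-] /= ij + [eE].
  rewrite -{}eE /= in ij * => le_gh.
  move: sj le_gh; rewrite -{j Tj}ij (it : sval i = t) => sj le_gh.
  rewrite ltn_neqAle le_gh andbT; apply/eqP => gh.
  by apply: (neq_uv _ Ss); exists (i, g t); rewrite si sj it gh.
(* That [u] and [v] each represent [T] does not place them on the same trace within one assignment,
   and elements of distinct traces are incomparable; [Suv] closes this gap. *)
have E s : S s -> exists i m n, [/\ s u = Some (i, m), s v = Some (i, n) & m < n].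
  move=> Ss; have [i Ti si] := Su _ Ss; have [j Tj sj] := Sv _ Ss.
  have [k [m [n []]]] := Suv _ Ss.
  rewrite si sj => -[ik _] -[jk _].
  by rewrite jk -ik; exists i, (g (val i)), (h (val i)); split => //; exact: lt_gh.
split=> s /E[i [m [n [si sj mn]]]].
  by exists (i, m), (i, n); split => //; split => //; exact: ltnW.
by move=> [d []]; rewrite si sj => -[<-] -[nm]; rewrite nm ltnn in mn.
Qed.

Lemma fsucc_sat S (u v w : fvar) : u != v -> u != w -> v != w ->
  fo_sat (trace_struct X) S (fsucc AP u v w) <->
  forall s, S s -> exists i n, s u = Some (i, n) /\ s v = Some (i, n.+1).
Proof.
move=> uv uw vw; split=> [[[le_uv neq_uv]] /= [S1 [S2 [SE]]]|succ_uv].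
  move=> [S3 [S4 [S1E S3le S4le]]] [S2nle1 S2nle2] s Ss.
  have [[i n] [[j m] [su sv [/= ij nm]]]] := le_uv _ Ss.
  rewrite -{j}ij in sv.
  exists i, n; split => //.
  have ltnm : n < m.
    rewrite ltn_neqAle nm andbT; apply/eqP => E.
    by apply: (neq_uv _ Ss); exists (i, n); rewrite su sv E.
  (* Test the universal quantifier at the true successor of [u]: it is comparable to [u] but not
     below it, so only the disjunct [v <= w] survives, giving [m <= n.+1]. *)
  pose s' := upd s w (i, n.+1).
  have s'w : s' w = Some (i, n.+1) by rewrite /s' upd_eq.
  have s'u : s' u = Some (i, n) by rewrite /s' upd_neq.
  have s'v : s' v = Some (i, m) by rewrite /s' upd_neq.
  have : (S1 `|` S2) s' by rewrite -SE; exists s, (i, n.+1).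
  rewrite S1E => -[[/S3le|/S4le]|/S2nle1].
  - move=> [d [e []]]; rewrite s'w s'u => -[<-] -[<-] [_ /=].
    by rewrite ltnn.
  - move=> [d [e []]]; rewrite s'w s'v => -[<-] -[<-] [_ /= mn].
    by rewrite sv; congr (Some (_, _)); apply/eqP; rewrite eqn_leq mn.
  - by case; exists (i, n), (i, n.+1); split => //; split => /=.
split.
  split=> s /succ_uv[i [n [su sv]]].
    by exists (i, n), (i, n.+1); split => //; split => //=.
  by move=> [d []]; rewrite su sv => -[<-] -[/esym/n_Sn].
pose W : team := [set s' | exists s a, S s /\ s' = upd s w a].
pose le_wu := [set s : assignment D | atom_holds (M := trace_struct X) s (ALe AP w u)].
pose le_vw := [set s : assignment D | atom_holds (M := trace_struct X) s (ALe AP v w)].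
(* All disjuncts are literals or conjunctions of literals, so the team can be split assignment by
   assignment. *)
exists (W `&` (le_wu `|` le_vw)), (W `\` (le_wu `|` le_vw)); split.
- by rewrite setUIDK.
- by exists (W `&` le_wu), (W `&` le_vw); split=> [|s []|s []] //; rewrite setIUr.
(* In the remainder, a [w] above [u] would lie on the trace of [u] at a position either at most [n]
   or at least [n.+1], hence in the first part after all. *)
split=> _ [[s [[j k] [Ss ->]]] nle] le_uw; apply: nle; last by left.
have [i [n [su sv]]] := succ_uv _ Ss.
move: le_uw => [d [e []]]; rewrite upd_neq// su upd_eq => -[<-] -[<-] [/= ij nk].
rewrite -{j}ij; have [kn|nk'] := leqP k n; [left|right].
  by exists (i, k), (i, n); rewrite upd_eq upd_neq.
by exists (i, n.+1), (i, k); rewrite upd_eq upd_neq.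
Qed.

(** The successor is already determined by the value of [u], so the translation of [LNext] can do
    without a dependence atom. *)
Lemma represents_succ S u v T g : represents S u T g ->
  (forall s, S s -> exists i n, s u = Some (i, n) /\ s v = Some (i, n.+1)) ->
  represents S v T (fun t => g t + 1).
Proof.
move=> [Su Tu] succ_uv.
have E s i n : S s -> s u = Some (i, n) -> s v = Some (i, n + 1).
  by move=> /succ_uv[j [m [-> ->]]] [-> ->]; rewrite addn1.
split=> [s Ss|t Tt].
  by have [i Ti si] := Su _ Ss; exists i => //; exact: E.
by have [s [i [Ss si it]]] := Tu _ Tt; exists s, i; split => //; exact: E.
Qed.

(** * The induction on formulas *)

Lemma ST_represents (phi : ltl AP) (u v w : fvar) S T g :
  u != v -> u != w -> v != w -> represents S u T g ->
  fam_sat (team_suffix id g) T phi <->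
  fo_sat (trace_struct X) S (ST u v w phi).
Proof.
elim: phi u v w S T g => [p|p|phi IH1 psi IH2|phi IH1 psi IH2|phi IH|phi IH
  |phi IH1 psi IH2] u v w S T g uv uw vw r /=.
- have [Su Tu] := r; split=> [H s Ss|H t Tt].
    have [i Ti si] := Su _ Ss; exists (i, g (val i)); split => //.
    by have := H _ Ti; rewrite /team_suffix addn0.
  have [s [i [Ss si it]]] := Tu _ Tt.
  have [d []] := H _ Ss; rewrite si => -[<-] /=.
  by rewrite it /team_suffix addn0.
- have [Su Tu] := r; split=> [H s Ss|H t Tt].
    have [i Ti si] := Su _ Ss; move=> [d []]; rewrite si => -[<-] /= pg.
    by apply: (H _ Ti); rewrite /team_suffix addn0.
  have [s [i [Ss si it]]] := Tu _ Tt.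
  rewrite /team_suffix addn0 => pg; apply: (H _ Ss); exists (i, g t).
  by split => //=; rewrite it.
- by rewrite (IH1 u v w S T g)// (IH2 u v w S T g).
- have [Su Tu] := r; split=> [[T1 [T2 [TE H1 H2]]]|[S1 [S2 [SE H1 H2]]]].
    (* A splitting of [T] is pulled back to [S] along the trace of [u]; a splitting of [S] is pushed
       forward by [proj] below. Overlapping parts are allowed on both sides. *)
    pose over (T' : set (trace AP)) : team :=
      [set s | S s /\ exists2 i : set_type X, T' (val i) & s u = Some (i, g (val i))].
    have r' T' : T' `<=` T -> represents (over T') u T' g.
      move=> T'T; split=> [s []|t T't]//.
      have [s [i [Ss si it]]] := Tu _ (T'T _ T't).
      by exists s, i; split => //; split => //; exists i; rewrite it.
    exists (over T1), (over T2); split.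
    + apply/seteqP; split=> s; last by case=> -[].
      move=> Ss; have [i] := Su _ Ss.
      by rewrite TE => -[Ti|Ti] si; [left|right]; split => //; exists i.
    + by apply/(IH1 u v w _ T1 g) => //; apply: r'; rewrite TE; exact: subsetUl.
    + by apply/(IH2 u v w _ T2 g) => //; apply: r'; rewrite TE; exact: subsetUr.
  pose proj (S' : team) : set (trace AP) :=
    [set t | exists s (i : set_type X), [/\ S' s, s u = Some (i, g t) & val i = t]].
  have r' S' : S' `<=` S -> represents S' u (proj S') g.
    move=> S'S; split=> [s S's|t //].
    by have [i Ti si] := Su _ (S'S _ S's); exists i => //; exists s, i.
  exists (proj S1), (proj S2); split.
  + apply/seteqP; split=> t.
      move=> /Tu[s [i [+ si it]]]; rewrite SE => -[Ss|Ss].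
        by left; exists s, i.
      by right; exists s, i.
    have projT s i : S s -> s u = Some (i, g t) -> val i = t -> T t.
      by move=> /Su[j Tj ->] [<- _] <-.
    by case=> -[s [i [Ss si it]]]; apply: (projT s i) => //; rewrite SE; [left|right].
  + by apply/(IH1 u v w S1) => //; apply: r'; rewrite SE; exact: subsetUl.
  + by apply/(IH2 u v w S2) => //; apply: r'; rewrite SE; exact: subsetUr.
- by rewrite (IH u v w S T g).
(* The recursive call rotates the variables, which is why they are generalized in the induction. *)
- have [vu wu] : v != u /\ w != u by rewrite !(eq_sym _ u).
  rewrite team_suffixD; split=> [H|[F [F0 [succ_uv H]]]].
    exists (shift u (fun=> 1)); split; first exact: shift_neq0 r.
    split; last by apply/(IH v w u _ T (fun t => g t + 1)) => //;
      exact: (represents_shift _ (fun=> 1) r).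
    apply/fsucc_sat => // _ [s [a [Ss [[i n] su ->] ->]]].
    by exists i, n; rewrite upd_neq// upd_eq /= addn1.
  have r' := represents_supplement uv F0 r.
  apply: (IH v w u _ T (fun t => g t + 1) vw vu wu _).2 H.
  by apply: (represents_succ r'); exact: (fsucc_sat _ uv uw vw).1 succ_uv.
have [[vu wu] wv] : (v != u /\ w != u) /\ w != v by rewrite !(eq_sym w) (eq_sym v).
(* The negated existential acts as a universal quantifier over functions [f'] below [f]: a guarded
   choice of [w] yields an [f'] by [represents_dep], and an [f'] yields one by [shift]. Leaving [S']
   arbitrary serves both directions of the until case. *)
have until_guard S' f : represents S' u T g ->
    fo_sat (trace_struct X) S' (fle AP u v) ->
    represents S' v T (fun t => g t + f t) ->
    (forall f' : trace AP -> nat, (forall t, T t -> f' t < f t) ->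
       fam_sat (team_suffix (team_suffix id g) f') T phi) <->
    ~ fo_sat (trace_struct X) S' (FEx w (FAnd (fle AP u w) (FAnd (flt AP w v)
        (FAnd (FDep AP [:: u] w) (FNot (ST w u v phi)))))).
  move=> ru le_uv rv.
  (* Both [v] and [w] lie above [u], hence on its trace; this is the side condition of
     [flt_represents]. *)
  have wv_same F : fo_sat (trace_struct X) (supplement S' w F) (fle AP u w) ->
      forall s, supplement S' w F s ->
      exists i m n, s w = Some (i, m) /\ s v = Some (i, n).
    move=> le_uw s S's.
    have [d [[i m] [su sw [/= di _]]]] := le_uw _ S's.
    have [s0 [a [S's0 _ sE]]] := S's.
    have [d' [[j n] [s0u s0v [/= d'j _]]]] := le_uv _ S's0.
    have su' : s u = Some d' by rewrite sE upd_neq.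
    have sv : s v = Some (j, n) by rewrite sE upd_neq.
    have ji : j = i by rewrite -d'j -di; move: su'; rewrite su => -[->].
    by exists i, m, n; rewrite sw sv ji.
  split=> [H [F [F0 [le_uw [lt_wv [dep nphi]]]]]|H f' f'f].
    have ru' := represents_supplement uw F0 ru.
    have rv' := represents_supplement vw F0 rv.
    have [f' rw'] := represents_dep ru' le_uw dep.
    apply: nphi; apply/(IH1 w u v _ T (fun t => g t + f' t)) => //.
    rewrite -team_suffixD; apply: H => t Tt.
    by rewrite -(ltn_add2l (g t)); apply: (flt_represents rw' rv' _).1 Tt => //; exact: wv_same.
  (* Classically, an [f'] at which [phi] fails becomes a witness for the existential over [w]. *)
  apply: contrapT => nphi; apply: H; exists (shift u f').
  have le_uw := fle_shift (f := f') uw ru.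
  have F0 := shift_neq0 f' ru.
  have rv' := represents_supplement vw F0 rv.
  have rw' := represents_shift w f' ru.
  split => //; split => //; split; last split.
  + apply/(flt_represents rw' rv'); first exact: wv_same.
    by move=> t Tt; rewrite ltn_add2l; exact: f'f.
  + exact: dep_shift.
  + move=> H; apply: nphi; rewrite team_suffixD.
    exact: (IH1 w u v _ T (fun t => g t + f' t) wu wv uv rw').2 H.
split=> [[f [H2 H1]]|[F [F0 [le_uv [dep [H2 H1]]]]]].
  exists (shift u f).
  have F0 := shift_neq0 f r.
  have le_uv := fle_shift (f := f) uv r.
  have ru := represents_supplement uv F0 r.
  have rv := represents_shift v f r.
  split => //; split => //; split; first exact: dep_shift.
  split; last exact/(until_guard _ f ru le_uv rv).
  by apply/(IH2 v w u _ T (fun t => g t + f t)); rewrite -?team_suffixD.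
have ru := represents_supplement uv F0 r.
have [f rv] := represents_dep ru le_uv dep.
exists f; split; last exact/(until_guard _ f ru le_uv rv).
by rewrite team_suffixD; exact: (IH2 v w u _ T (fun t => g t + f t) vw vu wu rv).2 H2.
Qed.

(** * The initial team *)

Lemma represents_init u : represents (init_team X u) u X (fun=> 0).
Proof.
split=> [_ [i ->]|t Xt].
  by exists i; [exact: set_valP | rewrite upd_eq].
exists (upd (fun=> None) u (SigSub (mem_set Xt), 0)), (SigSub (mem_set Xt)).
by split => //; [exists (SigSub (mem_set Xt)) | rewrite upd_eq].
Qed.

End Translation.

Theorem theorem1 (AP : Type) (phi : ltl AP) (T : set (trace AP))
    (hT : (T !=set0)%classic) :
  team_sat T phi <-> fo_sat (trace_struct T) (init_team T vx) (ST_x phi).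
(* Advancing every trace by 0 is the identity up to conversion, since [0 + k] computes to [k]. *)
Proof. exact: (@ST_represents AP T phi vx vy vz _ T (fun=> 0) _ _ _ (represents_init T vx)). Qed.
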